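(* Let $\alpha(n)$ be a log-polynomial sequence of degree $m\ge2$ with data $\{A(n),\kappa,\delta(n)\}$. Suppose the real sequences $A^*(n)$ and $\delta^*(n)>0$ satisfy $$A^*(n)=A(n)+o(\delta(n)),\qquad \delta^*(n)=\delta(n)(1+o(1))\qquad(n\to\infty).$$ Then $\alpha$ is Hermite-Jensen of degree $d$ with data $\{A^*(n),\kappa,\delta^*(n)\}$ for every $d$ with $1\le d\le m+1$.
   Context: Jensen polynomials: $J_\alpha^{d,n}(X)=\sum_{j=0}^d\binom{d}{j}\alpha(n+j)X^j$ and $K_\alpha^{d,n}(X)=X^dJ_\alpha^{d,n}(1/X)$. Limits of polynomials are coefficientwise. $H_d$ is the physicists' Hermite polynomial, $e^{2Xt-t^2}=\sum_d H_d(X)t^d/d!$. Log-polynomial: let $m\ge2$ be an integer and $\kappa\in\{1,-1\}$. A sequence of positive reals $\alpha(n)$ is log-polynomial of degree $m$ with data $\{A(n),\kappa,\delta(n)\}$ if there are real sequences $A(n),\delta(n),g_k(n)$ ($3\le k\le m$) such that $$\log\left(\frac{\alpha(n+j)}{\alpha(n)}\right)=A(n)j+\kappa\delta(n)^2j^2+\sum_{k=3}^m g_k(n)j^k+o(\delta(n)^{m+1})\quad(n\to\infty)$$ for $j=1,\dots,m+1$. In addition, $\delta(n)>0$, $\delta(n)\to0$ and $g_k(n)=o(\delta(n)^k)$. Hermite-Jensen: a sequence of positive reals $\alpha(n)$ is Hermite-Jensen of degree $d\ge1$ with data $\{A(n),\kappa,\delta(n)\}$ if, as $n\to\infty$, both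 $$\frac{\delta(n)^{-d}}{\alpha(n)}J_\alpha^{d,n}\!\left(\frac{\delta(n)X-1}{e^{A(n)}}\right)\quad\text{and}\quad\frac{(e^{A(n)}\delta(n))^{-d}}{\alpha(n)}K_\alpha^{d,n}\!\left(e^{A(n)}(\delta(n)X-1)\right)$$ converge coefficientwise to $H_d(X/2)$ if $\kappa=-1$, and to $i^{-d}H_d(iX/2)$ if $\kappa=1$. *)

(* Defs.v *)
From HB Require Import structures.
From mathcomp Require Import all_boot all_order all_algebra.
From mathcomp Require Import complex.
From mathcomp Require Import all_classical all_reals all_analysis.
Set Implicit Arguments. Unset Strict Implicit. Unset Printing Implicit Defensive.
Import Order.TTheory GRing.Theory Num.Theory.
Import numFieldNormedType.Exports.
Local Open Scope ring_scope.
Local Open Scope classical_set_scope.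

Definition jensenJ (R : realType) (a : nat -> R) (d n : nat) : {poly R} :=
  \sum_(j < d.+1) ('C(d, j)%:R * a (n + j)%N) *: 'X^j.

(* K_alpha^{d,n}(X) = X^d J_alpha^{d,n}(1/X) = sum_{j=0}^d C(d,j) alpha(n+j) X^(d-j) *)
Definition jensenK (R : realType) (a : nat -> R) (d n : nat) : {poly R} :=
  \sum_(j < d.+1) ('C(d, j)%:R * a (n + j)%N) *: 'X^(d - j).

(* Physicists' Hermite polynomial: the coefficient of t^d/d! in
   e^{2Xt} e^{-t^2}, i.e. H_d(X) = d! sum_k (-1)^k (2X)^(d-2k) / (k! (d-2k)!). *)
Definition hermite (F : fieldType) (d : nat) : {poly F} :=
  \sum_(k < d./2.+1)
     ((-1) ^+ k * (d`!)%:R / ((k`!)%:R * ((d - 2 * k)`!)%:R))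
       *: (2%:R *: 'X) ^+ (d - 2 * k).

Definition hj_target (R : realType) (kappa : R) (d : nat) : {poly R[i]} :=
  if kappa == -1 then hermite R[i] d \Po ((2%:R)^-1 *: 'X)
  else ('i%C ^- d) *: (hermite R[i] d \Po (('i%C / 2%:R) *: 'X)).

Definition cvgC (R : realType) (u : nat -> R[i]) (l : R[i]) : Prop :=
  (fun n => complex.Re (u n)) @ \oo --> complex.Re l /\
  (fun n => complex.Im (u n)) @ \oo --> complex.Im l.

Definition poly_cvg (R : realType) (P : nat -> {poly R}) (Q : {poly R[i]}) : Prop :=
  forall k : nat, cvgC (fun n => ((P n)`_k)%:C%C) Q`_k.

Definition log_polynomial (R : realType) (a : nat -> R) (m : nat)
    (A : nat -> R) (kappa : R) (delta : nat -> R) : Prop :=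
  [/\ (2 <= m)%N, kappa = 1 \/ kappa = -1, (forall n, 0 < a n),
      (forall n, 0 < delta n) /\ delta @ \oo --> 0 &
      exists g : nat -> nat -> R,
        (forall j : nat, (1 <= j <= m.+1)%N ->
           (fun n => (ln (a (n + j)%N / a n)
                      - (A n * j%:R + kappa * delta n ^+ 2 * j%:R ^+ 2
                         + \sum_(3 <= k < m.+1) g k n * j%:R ^+ k))
                     / delta n ^+ m.+1) @ \oo --> 0)
        /\ (forall k : nat, (3 <= k <= m)%N ->
              (fun n => g k n / delta n ^+ k) @ \oo --> 0)].

Definition hermite_jensen (R : realType) (a : nat -> R) (d : nat)
    (A : nat -> R) (kappa : R) (delta : nat -> R) : Prop :=
  [/\ (1 <= d)%N, kappa = 1 \/ kappa = -1, (forall n, 0 < a n),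
      poly_cvg (fun n => (delta n ^- d / a n) *:
                  (jensenJ a d n \Po ((delta n *: 'X - 1) * ((expR (A n))^-1)%:P)))
               (hj_target kappa d) &
      poly_cvg (fun n => ((expR (A n) * delta n) ^- d / a n) *:
                  (jensenK a d n \Po (expR (A n) *: (delta n *: 'X - 1))))
               (hj_target kappa d)].

(* Main.v *)
(* With F n j = a (n + j) / (a n * e^(Astar n * j)), the X^k coefficient of
   either renormalised polynomial is, up to the sign (-1)^(d-k),
   C(d, k) * deltastar^-(d-k) times the alternating binomial sum of order
   r = d - k of j |-> F n j (based at k for J, at 0 for K).  Up to
   o(delta^m.+1), F n j = exp (Q_n (delta * j)), where Q_n is a polynomial
   without constant term whose coefficients converge to those of kappa X^2.
   Truncating exp at order r costs o(delta^r) and leaves a polynomial in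
   delta * j; the alternating sum kills its terms of degree < r and multiplies
   the one of degree r by (-1)^r r! delta^r.  So the coefficient tends to
   C(d, k) r! [y^r] exp (kappa y^2), which vanishes for odd r and is the
   Hermite coefficient for even r. *)
Require Import Defs.
From HB Require Import structures.
From mathcomp Require Import all_boot all_order all_algebra.
From mathcomp Require Import complex.
From mathcomp Require Import all_classical all_reals all_analysis.
From mathcomp Require Import zify ring lra.
Import Order.TTheory GRing.Theory Num.Theory.
Import numFieldNormedType.Exports.
Local Open Scope ring_scope.
Local Open Scope classical_set_scope.

Set Implicit Arguments.
Unset Strict Implicit.
Unset Printing Implicit Defensive.

(** * Alternating binomial sums as iterated differences *)

Definition altsum (R : pzRingType) (f : nat -> R) (r : nat) : R :=
  \sum_(i < r.+1) (-1) ^+ i * 'C(r, i)%:R * f i.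

(** Pascal's rule splits each binomial. The difference is [f i - f i.+1], the opposite of the
    forward one, which is where the later factor [(-1) ^+ r] comes from. *)
Lemma altsumS (R : pzRingType) (f : nat -> R) r :
  altsum f r.+1 = altsum (fun i => f i - f i.+1) r.
Proof.
rewrite /altsum big_ord_recl /=.
under eq_bigr => i _ do
  rewrite /bump /= add1n binS natrD mulrDr mulrDl exprS.
rewrite big_split /= addrA big_ord_recr /= (bin_small (ltnSn r)) mulr0 mul0r addr0.
have -> : (-1) ^+ 0 * 'C(r.+1, 0)%:R * f 0 +
    \sum_(i < r) -1 * (-1) ^+ i * 'C(r, i.+1)%:R * f i.+1 =
    \sum_(i < r.+1) (-1) ^+ i * 'C(r, i)%:R * f i.
  rewrite big_ord_recl !bin0; congr (_ + _).
  by apply: eq_bigr => i _; rewrite lift0 exprS.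
rewrite -big_split /=; apply: eq_bigr => i _.
by rewrite mulrBr !mulN1r !mulNr.
Qed.

Lemma coef_comp_polyXaddC1 (R : comNzRingType) (p : {poly R}) N i :
  (size p <= N)%N ->
  (p \Po ('X + 1))`_i = \sum_(j < N) p`_j * 'C(j, i)%:R.
Proof.
move=> sp; rewrite -{1}(take_poly_id sp) /take_poly poly_def raddf_sum /= coef_sum.
apply: eq_bigr => j _.
rewrite comp_polyZ comp_Xn_poly coefZ exprD1n coef_sum; congr (_ * _).
under eq_bigr => k _ do rewrite coefMn coefXn.
have [ij|ji] := leqP i j.
  have ij1 : (i < j.+1)%N by [].
  rewrite (bigD1 (Ordinal ij1)) //= big1 ?addr0 ?eqxx //.
  move=> k /eqP neq; case: eqP => [ik|]; last by rewrite mul0rn.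
  by case: neq; apply/val_inj.
rewrite bin_small // big1 // => k _; case: eqP => [ik|]; last by rewrite mul0rn.
by move: (ltn_ord k); rewrite -ik ltnS leqNgt ji.
Qed.

(** Induction on [r]: by [altsumS], one order of the sum trades [p] for [p(X) - p(X + 1)], which
    loses a degree and has top coefficient [-(r + 1)] times that of [p]. The base point [x] is
    arbitrary and drops out. *)
Lemma altsum_horner (R : comNzRingType) (p : {poly R}) (x : R) r :
  (size p <= r.+1)%N ->
  altsum (fun i => p.[x + i%:R]) r = (-1) ^+ r * r`!%:R * p`_r.
Proof.
elim: r p => [|r IH] p sp.
  rewrite /altsum big_ord1 bin0 fact0 !mul1r addr0.
  by rewrite (size1_polyC sp) hornerC coefC.
rewrite altsumS.
pose q := p - (p \Po ('X + 1)).
rewrite (_ : altsum _ r = altsum (fun i => q.[x + i%:R]) r); last first.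
  apply: eq_bigr => i _.
  by rewrite /q hornerD hornerN horner_comp !hornerE -addrA natr1.
(* As [size p <= r.+2], only the terms [j = r] and [j = r.+1] of the shifted polynomial reach index
   [r] or above; the diagonal ones cancel against [p]. *)
have qE i : (r <= i)%N -> q`_i = if i == r then - p`_r.+1 *+ r.+1 else 0.
  move=> ri; rewrite /q coefB (coef_comp_polyXaddC1 _ sp).
  rewrite !big_ord_recr /= big1 ?add0r; last first.
    by move=> j _; rewrite bin_small ?mulr0 // (leq_trans (ltn_ord j)).
  case: eqP => [->|/eqP ir].
    by rewrite binn mulr1 binSn opprD addrA subrr sub0r mulNrn mulr_natr.
  have {ri ir} ri : (r < i)%N by rewrite ltn_neqAle eq_sym ir.
  rewrite (bin_small ri) mulr0 add0r.
  move: ri; rewrite leq_eqVlt => /orP[/eqP <-|ri].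
    by rewrite binn mulr1 subrr.
  by rewrite bin_small // mulr0 subr0 nth_default // (leq_trans sp).
rewrite IH; last first.
  by apply/leq_sizeP => i ri; rewrite qE ?(ltnW ri) // gtn_eqF.
rewrite qE // eqxx factS natrM exprS -mulr_natr; ring.
Qed.

Lemma altsum_expn (R : comNzRingType) (k q r : nat) :
  (q <= r)%N ->
  altsum (fun i => (k + i)%:R ^+ q) r =
  (if q == r then (-1) ^+ r * r`!%:R else 0) :> R.
Proof.
move=> qr; have := @altsum_horner R 'X^q k%:R r.
rewrite size_polyXn ltnS => /(_ qr); rewrite coefXn.
under [X in altsum X]eq_fun => i do rewrite hornerXn -natrD.
by move=> ->; rewrite eq_sym; case: eqP => _; rewrite ?mulr1 ?mulr0.
Qed.

(** * Taylor polynomials of the exponential *)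

(** [r] counts terms, so the degree is below [r]. Order 0 is the zero polynomial, a convenient base
    for induction. *)
Definition expR_poly (R : realType) (r : nat) : {poly R} :=
  \poly_(l < r) (l`!%:R)^-1.

Lemma deriv_expR_poly (R : realType) r :
  deriv (expR_poly R r.+1) = expR_poly R r.
Proof.
apply/polyP => i; rewrite coef_deriv !coef_poly ltnS.
case: ifP => _; last by rewrite mul0rn.
by rewrite -[LHS]mulr_natl factS natrM invfM mulrA mulfV ?mul1r ?pnatr_eq0.
Qed.

Lemma expR_poly0 (R : realType) r : (expR_poly R r.+1).[0] = 1.
Proof. by rewrite horner_coef0 coef_poly /= fact0 invr1. Qed.

(** The error of order [r.+1] vanishes at 0 and has the error of order [r] as derivative, so the
    mean value theorem gains one factor [|x|] per step. The constant [expR 1] is the bound of the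
    base case on [|x| <= 1]. *)
Lemma expR_poly_approx (R : realType) r (x : R) : `|x| <= 1 ->
  `|expR x - (expR_poly R r).[x]| <= expR 1 * `|x| ^+ r.
Proof.
elim: r x => [|r IH] x x1.
  rewrite /expR_poly poly_def big_ord0 horner0 subr0 expr0 mulr1.
  by rewrite ger0_norm ?expR_ge0 // ler_expR (le_trans (ler_norm _)).
pose f (y : R) := expR y - (expR_poly R r.+1).[y].
pose df (y : R) := expR y - (expR_poly R r).[y].
have fdrv (y : R) : is_derive y 1 f (df y).
  rewrite /df -deriv_expR_poly.
  exact: is_deriveB (is_derive_expR y) (is_derive_poly _ y).
have fcont (y z : R) : {within `[y, z], continuous f}.
  apply: continuous_subspaceT => t.
  apply: differentiable_continuous; apply/derivable1_diffP.
  by have [] := fdrv t.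
have f0 : f 0 = 0 by rewrite /f expR0 expR_poly0 subrr.
have bound c : `|c| <= `|x| -> `|df c * x| <= expR 1 * `|x| ^+ r.+1.
  move=> cx; rewrite normrM exprSr mulrA ler_wpM2r //.
  apply: le_trans (IH c (le_trans cx x1)) _.
  by rewrite ler_wpM2l ?expR_ge0 // lerXn2r ?nnegrE.
(* The mean value theorem needs ordered endpoints, hence the split on the sign of [x]. *)
rewrite -/(f x); have [x0|x0] := leP 0 x.
  have [c cI] := @MVT_segment R f df 0 x x0 (fun y _ => fdrv y) (fcont _ _).
  rewrite f0 !subr0 => ->; apply: bound.
  move: cI; rewrite in_itv /= => /andP[c0 cx].
  by rewrite !ger0_norm.
have [c cI] := @MVT_segment R f df x 0 (ltW x0) (fun y _ => fdrv y) (fcont _ _).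
rewrite f0 !sub0r mulrN => /oppr_inj ->; apply: bound.
move: cI; rewrite in_itv /= => /andP[c0 cx].
by rewrite !ler0_norm ?lerN2 // ltW.
Qed.

(** * Coefficientwise limits of real polynomials *)

Lemma cvg_sum_nat (R : realType) (N : nat) (f : nat -> nat -> R) (l : nat -> R) :
  (forall i, (i < N)%N -> f i @ \oo --> l i) ->
  (fun n => \sum_(i < N) f i n) @ \oo --> \sum_(i < N) l i.
Proof.
elim: N => [|N IH] fl.
  by under eq_fun do rewrite big_ord0; rewrite big_ord0; exact: cvg_cst.
under eq_fun do rewrite big_ord_recr; rewrite big_ord_recr /=.
by apply: cvgD; [apply: IH => i iN; apply: fl; exact: ltnW | exact: fl].
Qed.

Lemma cvg_pow_seq (R : realType) (u : nat -> R) (l : R) k :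
  u @ \oo --> l -> (fun n => u n ^+ k) @ \oo --> l ^+ k.
Proof.
move=> ul; elim: k => [|k IH]; first by under eq_fun do rewrite expr0; exact: cvg_cst.
by under eq_fun do rewrite exprS; rewrite exprS; exact: cvgM.
Qed.

Definition coef_cvg (R : realType) (P : nat -> {poly R}) (Q : {poly R}) : Prop :=
  forall k : nat, (fun n => (P n)`_k) @ \oo --> Q`_k.

Lemma coef_cvgM (R : realType) (P P' : nat -> {poly R}) (Q Q' : {poly R}) :
  coef_cvg P Q -> coef_cvg P' Q' -> coef_cvg (fun n => P n * P' n) (Q * Q').
Proof.
move=> PQ PQ' k; under eq_fun do rewrite coefM; rewrite coefM.
by apply: (@cvg_sum_nat _ k.+1 (fun i n => (P n)`_i * (P' n)`_(k - i))
  (fun i => Q`_i * Q'`_(k - i))) => i _; exact: cvgM.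
Qed.

Lemma coef_cvgX (R : realType) (P : nat -> {poly R}) (Q : {poly R}) e :
  coef_cvg P Q -> coef_cvg (fun n => P n ^+ e) (Q ^+ e).
Proof.
move=> PQ; elim: e => [|e IH].
  by move=> k; under eq_fun do rewrite expr0; rewrite expr0; exact: cvg_cst.
by move=> k; under eq_fun do rewrite exprS; rewrite exprS; exact: coef_cvgM.
Qed.

(** The outer polynomial [T] is fixed, so each coefficient of the composition is a sum whose length
    does not depend on [n]. *)
Lemma coef_cvg_comp (R : realType) (T : {poly R}) (P : nat -> {poly R}) (Q : {poly R}) :
  coef_cvg P Q -> coef_cvg (fun n => T \Po P n) (T \Po Q).
Proof.
move=> PQ k; under eq_fun do rewrite coef_comp_poly; rewrite coef_comp_poly.
apply: (@cvg_sum_nat _ _ (fun i n => T`_i * (P n ^+ i)`_k)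
  (fun i => T`_i * (Q ^+ i)`_k)) => i _.
by apply: cvgM; [exact: cvg_cst | exact: coef_cvgX].
Qed.

(** The bound [N] replaces the size of [p], so that a sequence of polynomials can be expanded with a
    number of terms independent of [n]. *)
Lemma horner_scaled (R : comNzRingType) (p : {poly R}) N (d x : R) :
  (size p <= N)%N -> p.[d * x] = \sum_(q < N) p`_q * d ^+ q * x ^+ q.
Proof.
move=> /horner_coef_wide ->; apply: eq_bigr => q _.
by rewrite exprMn mulrA.
Qed.

(** * Asymptotics on the scale of powers of [delta] *)

Section Asymptotics.
Variables (R : realType) (delta : nat -> R).
Hypotheses (delta_gt0 : forall n, 0 < delta n) (delta0 : delta @ \oo --> 0).

Let delta_neq0 n : delta n != 0.
Proof. by rewrite gt_eqF. Qed.

Lemma cvg_delta_pos q : (0 < q)%N -> (fun n => delta n ^+ q) @ \oo --> 0.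
Proof. by move=> q0; have := @cvg_pow_seq _ _ _ q delta0; rewrite expr0n gtn_eqF. Qed.

Lemma cvg_div_delta_le (u : nat -> R) (r s : nat) : (r <= s)%N ->
  (fun n => u n / delta n ^+ s) @ \oo --> 0 ->
  (fun n => u n / delta n ^+ r) @ \oo --> 0.
Proof.
move=> rs us; have -> : (fun n => u n / delta n ^+ r) =
    (fun n => (u n / delta n ^+ s) * delta n ^+ (s - r)).
  apply/funext => n; rewrite -{1}(subnK rs) exprD; field.
  by rewrite !expf_neq0.
(* For [r = s] the factor [0 ^+ (s - r)] is 1, but the product is still 0. *)
by rewrite -(mul0r (0 ^+ (s - r))); apply: cvgM => //; exact: cvg_pow_seq.
Qed.

(** The truncation order [s] and the scale [r] are kept apart for two uses: [s = r.+1] for a Taylor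
    expansion, and [s = 1] for an exponential close to 1. *)
Lemma cvg_expR_remainder (u : nat -> R) (r s : nat) :
  u @ \oo --> 0 ->
  (fun n => u n ^+ s / delta n ^+ r) @ \oo --> 0 ->
  (fun n => (expR (u n) - (expR_poly R s).[u n]) / delta n ^+ r) @ \oo --> 0.
Proof.
move=> u0 ur; apply: norm_cvg0.
apply: (@squeeze_cvgr _ _ _ _ (fun=> 0)
   (fun n => expR 1 * `|u n ^+ s / delta n ^+ r|)); last 2 first.
- exact: cvg_cst.
- rewrite -(mulr0 (expR 1)); apply: cvgM; first exact: cvg_cst.
  by rewrite -(normr0 R); exact: cvg_norm.
have : \forall n \near \oo, `|u n| <= 1.
  by move/cvgr0_norm_le : u0; apply; exact: ltr01.
apply: filterS => n un; rewrite normr_ge0 /= !normrM mulrA normrX.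
by rewrite ler_wpM2r // expR_poly_approx.
Qed.

Lemma cvg_poly_delta (P : nat -> {poly R}) (L : {poly R}) (M : nat) (x : R) :
  (forall n, (size (P n) <= M)%N) -> coef_cvg P L -> (size L <= M)%N ->
  (fun n => (P n).[delta n * x]) @ \oo --> L`_0.
Proof.
move=> sP PL sL; rewrite -horner_coef0 -[0](mul0r x) (horner_scaled _ _ sL).
under eq_fun do rewrite (horner_scaled _ _ (sP _)).
apply: (@cvg_sum_nat _ _ (fun q n => (P n)`_q * delta n ^+ q * x ^+ q)
  (fun q => L`_q * 0 ^+ q * x ^+ q)) => q _.
apply: cvgM; last exact: cvg_cst.
by apply: cvgM; [exact: PL | exact: cvg_pow_seq].
Qed.

(** In powers of [delta], the terms with [q < r] are annihilated by the alternating sum, the term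
    [q = r] survives, and those with [q > r] keep a positive power of [delta]. *)
Lemma cvg_altsum_horner (P : nat -> {poly R}) (L : {poly R}) (M k r : nat) :
  (forall n, (size (P n) <= M)%N) -> coef_cvg P L -> (r < M)%N ->
  (fun n => altsum (fun i => (P n).[delta n * (k + i)%:R]) r / delta n ^+ r)
    @ \oo --> (-1) ^+ r * r`!%:R * L`_r.
Proof.
move=> sP PL rM.
(* For [q < r] the quotient of powers would blow up; it may be replaced by 0 because the alternating
   sum it multiplies is 0. *)
have -> : (fun n => altsum (fun i => (P n).[delta n * (k + i)%:R]) r / delta n ^+ r)
  = (fun n => \sum_(q < M)
      (P n)`_q * (if (q < r)%N then 0 else delta n ^+ (q - r)) *
      altsum (fun i => (k + i)%:R ^+ q) r).
  apply/funext => n; rewrite /altsum mulr_suml.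
  under eq_bigr => i _ do rewrite (horner_scaled _ _ (sP n)) mulr_sumr mulr_suml.
  rewrite exchange_big /=; apply: eq_bigr => q _.
  have [qr|rq] := ltnP q r.
    have := @altsum_expn R k q r (ltnW qr); rewrite ltn_eqF // /altsum => E0.
    rewrite mulr0 mul0r.
    transitivity ((P n)`_q * delta n ^+ q / delta n ^+ r *
      \sum_(i < r.+1) (-1) ^+ i * 'C(r, i)%:R * (k + i)%:R ^+ q); last first.
      by rewrite E0 mulr0.
    by rewrite mulr_sumr; apply: eq_bigr => i _; ring.
  rewrite mulr_sumr; apply: eq_bigr => i _.
  have -> : delta n ^+ q = delta n ^+ (q - r) * delta n ^+ r.
    by rewrite -exprD subnK.
  by field; rewrite expf_neq0.
have -> : (-1) ^+ r * r`!%:R * L`_r = \sum_(q < M)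
    L`_q * (if q == r :> nat then 1 else 0) * altsum (fun i => (k + i)%:R ^+ q) r.
  rewrite (bigD1 (Ordinal rM)) //= eqxx altsum_expn // eqxx big1 ?addr0.
    by rewrite mulr1 mulrC.
  by move=> q; rewrite -val_eqE /= => /negbTE ->; rewrite mulr0 mul0r.
apply: (@cvg_sum_nat _ _ (fun q n => (P n)`_q *
   (if (q < r)%N then 0 else delta n ^+ (q - r)) *
      altsum (fun i => (k + i)%:R ^+ q) r)
  (fun q => L`_q * (if q == r :> nat then 1 else 0) *
      altsum (fun i => (k + i)%:R ^+ q) r)) => q _.
apply: cvgM; last exact: cvg_cst.
apply: cvgM; first exact: PL.
case: ltngtP => [qr|rq|->].
- exact: cvg_cst.
- by apply: cvg_delta_pos; rewrite subn_gt0.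
- by under eq_fun do rewrite subnn expr0; exact: cvg_cst.
Qed.

(** Replacing [expR (E n j)] by the truncated exponential of [Q n] costs an error negligible against
    [delta ^+ r], and the composed polynomial is then covered by [cvg_altsum_horner]. *)
Lemma cvg_altsum_expR (E : nat -> nat -> R) (Q : nat -> {poly R}) (L : {poly R})
    (M k r : nat) :
  (forall n, (size (Q n) <= M)%N) -> coef_cvg Q L -> (size L <= M)%N ->
  L`_1 = 0 -> (forall n, (Q n)`_0 = 0) ->
  (forall j, (j <= k + r)%N ->
    (fun n => (E n j - (Q n).[delta n * j%:R]) / delta n ^+ r) @ \oo --> 0) ->
  (fun n => altsum (fun i => expR (E n (k + i)%N)) r / delta n ^+ r)
    @ \oo --> (-1) ^+ r * r`!%:R * (expR_poly R r.+1 \Po L)`_r.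
Proof.
move=> sQ QL sL L1 Q0 EQ.
pose q n j := (Q n).[delta n * j%:R].
(* Without constant term, [Q n] is divisible by ['X], which absorbs the division by [delta n]. *)
have qE n j : q n j / delta n = (drop_poly 1 (Q n)).[delta n * j%:R] * j%:R.
  have dropQ : Q n = drop_poly 1 (Q n) * 'X.
    rewrite -[LHS](poly_take_drop 1 (Q n)) expr1 (size1_polyC (size_take_poly _ _)).
    by rewrite coef_take_poly /= Q0 polyC0 add0r.
  by rewrite /q {1}dropQ hornerMX; field.
have q_delta j : (fun n => q n j / delta n) @ \oo --> 0.
  under eq_fun do rewrite qE.
  rewrite -(mul0r j%:R); apply: cvgM; last exact: cvg_cst.
  have -> : 0 = (drop_poly 1 L)`_0 by rewrite coef_drop_poly L1.
  apply: (@cvg_poly_delta _ _ M).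
  - by move=> n; rewrite size_drop_poly (leq_trans (leq_subr _ _)).
  - move=> i; under eq_fun do rewrite coef_drop_poly.
    by rewrite coef_drop_poly; exact: QL.
  - by rewrite size_drop_poly (leq_trans (leq_subr _ _)).
have q0 j : (fun n => q n j) @ \oo --> 0.
  have -> : (fun n => q n j) = (fun n => q n j / delta n * delta n).
    by apply/funext => n; rewrite divfK.
  by rewrite -(mul0r 0); apply: cvgM.
have expq1 j : (fun n => expR (q n j)) @ \oo --> (1 : R).
  by rewrite -(expR0 R); apply: (cvg_comp _ _ (q0 j)); exact: continuous_expR.
have taylor_q j : (fun n => (expR (q n j) - (expR_poly R r.+1).[q n j])
    / delta n ^+ r) @ \oo --> 0.
  apply: cvg_expR_remainder => //.
  have -> : (fun n => q n j ^+ r.+1 / delta n ^+ r) =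
      (fun n => (q n j / delta n) ^+ r.+1 * delta n).
    apply/funext => n; rewrite expr_div_n [delta n ^+ r.+1]exprS; field.
    by rewrite expf_neq0 ?delta_neq0.
  by rewrite -(mulr0 (0 ^+ r.+1)); apply: cvgM => //; exact: cvg_pow_seq.
have expE j : (j <= k + r)%N ->
    (fun n => (expR (E n j) - (expR_poly R r.+1).[q n j]) / delta n ^+ r)
      @ \oo --> 0.
  move=> /EQ; rewrite -/q => eta.
  (* Write [expR (E n j)] as [expR (q n j) * expR (E n j - q n j)]; the second factor is compared
     with its one-term truncation, the constant 1. *)
  have -> : (fun n => (expR (E n j) - (expR_poly R r.+1).[q n j]) / delta n ^+ r)
    = (fun n => expR (q n j) * ((expR (E n j - q n j) - (expR_poly R 1).[E n j - q n j])
        / delta n ^+ r) + (expR (q n j) - (expR_poly R r.+1).[q n j]) / delta n ^+ r).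
    apply/funext => n.
    have -> : (expR_poly R 1).[E n j - q n j] = 1.
      by rewrite /expR_poly (size1_polyC (size_poly _ _)) hornerC coef_poly /= fact0 invr1.
    rewrite mulrA -mulrDl mulrBr -expRD mulr1; congr (_ / _).
    by rewrite [q n j + _]addrC subrK; ring.
  rewrite -[0](addr0 0); apply: cvgD => //.
  rewrite -[0](mulr0 1); apply: cvgM => //.
  apply: cvg_expR_remainder; last by under eq_fun do rewrite expr1.
  by have := cvg_div_delta_le (leq0n r) eta; under eq_fun do rewrite expr0 divr1.
have -> : (fun n => altsum (fun i => expR (E n (k + i)%N)) r / delta n ^+ r) =
  (fun n => \sum_(i < r.+1) (-1) ^+ i * 'C(r, i)%:R *
      ((expR (E n (k + i)%N) - (expR_poly R r.+1).[q n (k + i)%N]) / delta n ^+ r)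
    + altsum (fun i => (expR_poly R r.+1 \Po Q n).[delta n * (k + i)%:R]) r
      / delta n ^+ r).
  apply/funext => n; rewrite /altsum !mulr_suml -big_split /=.
  by apply: eq_bigr => i _; rewrite horner_comp -/(q n (k + i)%N); ring.
rewrite -[X in _ --> X]add0r; apply: cvgD.
  have := @cvg_sum_nat R r.+1 (fun i n => (-1) ^+ i * 'C(r, i)%:R *
      ((expR (E n (k + i)%N) - (expR_poly R r.+1).[q n (k + i)%N]) / delta n ^+ r))
    (fun=> 0).
  rewrite big1 //; apply => i ir; rewrite -[0](mulr0 ((-1) ^+ i * 'C(r, i)%:R)).
  by apply: cvgM; [exact: cvg_cst | apply: expE; rewrite leq_add2l].
(* The entry built from [r * M] bounds the size of the composition, since the truncated exponential
   has degree at most [r]; the entry [r.+1] keeps index [r] in range. *)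
apply: (@cvg_altsum_horner _ _ (maxn r.+1 (r * M).+1)); last exact: leq_maxl.
- move=> n; apply: leq_trans (size_comp_poly_leq _ _) _.
  apply: leq_trans (leq_maxr _ _); rewrite ltnS.
  apply: leq_mul; last exact: leq_trans (leq_pred _) (sQ n).
  by rewrite -subn1 leq_subLR add1n size_poly.
- exact: coef_cvg_comp.
Qed.
End Asymptotics.

(** * Coefficients of the renormalised Jensen polynomials *)

Lemma mul_bin_bin (d k i : nat) : (k + i <= d)%N ->
  ('C(d, k + i) * 'C(k + i, k) = 'C(d, k) * 'C(d - k, i))%N.
Proof.
move=> kid; have kd : (k <= d)%N := leq_trans (leq_addr _ _) kid.
have id : (i <= d - k)%N by rewrite leq_subRL.
apply/eqP.
rewrite -(@eqn_pmul2r (k`! * i`! * (d - (k + i))`!)) ?muln_gt0 ?fact_gt0 //.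
apply/eqP; transitivity d`!.
  rewrite -(bin_fact kid) -(bin_fact (leq_addr i k)) [(k + i - k)%N]addKn; ring.
by rewrite -(bin_fact kd) -(bin_fact id) subnDA; ring.
Qed.

Lemma coef_exp_linear (R : comNzRingType) (u : R) j k :
  ((u *: 'X - 1) ^+ j)`_k = 'C(j, k)%:R * u ^+ k * (-1) ^+ (j - k).
Proof.
rewrite addrC exprDn coef_sum.
have tE (i : 'I_j.+1) :
    ((-1) ^+ (j - i) * (u *: 'X) ^+ i *+ 'C(j, i))`_k =
    if k == i :> nat then 'C(j, k)%:R * u ^+ k * (-1) ^+ (j - k) else 0.
  rewrite coefMn exprZn -scalerAr coefZ.
  have -> : (-1) ^+ (j - i) = ((-1) ^+ (j - i))%:P :> {poly R}.
    by rewrite polyC_exp polyCN.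
  rewrite coefCM coefXn; case: eqP => [->|_]; last by rewrite !mulr0 mul0rn.
  by rewrite mulr1 -mulr_natl; ring.
rewrite (eq_bigr _ (fun i _ => tE i)).
have [jk|kj] := ltnP j k.
  rewrite bin_small // !mul0r big1 // => i _; by case: ifP.
rewrite -ltnS in kj; rewrite (bigD1 (Ordinal kj)) //= eqxx big1 ?addr0 // => i.
by rewrite -val_eqE /= eq_sym => /negbTE ->.
Qed.

(** Only the powers [j >= k] contribute to the coefficient of index [k]; setting [j = k + i] places
    the alternating sum at base [k]. *)
Lemma coef_jensenJ_comp (R : realType) (a : nat -> R) (d n : nat) (u b : R) k :
  (jensenJ a d n \Po ((u *: 'X - 1) * (b^-1)%:P))`_k =
  'C(d, k)%:R * u ^+ k * altsum (fun i => a (n + (k + i))%N / b ^+ (k + i)) (d - k).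
Proof.
pose G j := 'C(d, j)%:R * 'C(j, k)%:R * u ^+ k * (-1) ^+ (j - k) * (a (n + j)%N / b ^+ j).
have -> : (jensenJ a d n \Po ((u *: 'X - 1) * (b^-1)%:P))`_k =
    \sum_(0 <= j < d.+1) G j.
  rewrite /jensenJ raddf_sum /= coef_sum big_mkord; apply: eq_bigr => j _.
  rewrite comp_polyZ comp_Xn_poly coefZ exprMn -polyC_exp coefMC coef_exp_linear.
  by rewrite exprVn /G; ring.
have [dk|kd] := ltnP d k.
  rewrite bin_small // !mul0r big_mkord big1 // => j _.
  by rewrite /G ['C(j, k)]bin_small ?mulr0 ?mul0r // (leq_ltn_trans _ dk) // -ltnS.
rewrite (@big_cat_nat _ _ _ k) //=; last exact: leqW.
rewrite big_nat big1 ?add0r; last first.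
  by move=> j /andP[_ jk]; rewrite /G ['C(j, k)]bin_small ?mulr0 ?mul0r.
rewrite -{1}[k]add0n big_addn subSn // big_mkord /altsum mulr_sumr.
apply: eq_bigr => i _; rewrite /G addnC addKn -natrM mul_bin_bin ?natrM; last first.
  by rewrite -leq_subRL // -ltnS.
ring.
Qed.

(** Reversed exponents cut the sum from above, at [j <= d - k], so its base is 0. The sign
    [(-1) ^+ (d - k - i)] leaves a global [(-1) ^+ (d - k)]. *)
Lemma coef_jensenK_comp (R : realType) (a : nat -> R) (d n : nat) (u b : R) k :
  b != 0 ->
  (jensenK a d n \Po (b *: (u *: 'X - 1)))`_k =
  'C(d, k)%:R * u ^+ k * b ^+ d * (-1) ^+ (d - k) *
    altsum (fun i => a (n + i)%N / b ^+ i) (d - k).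
Proof.
move=> b0.
pose G j := 'C(d, j)%:R * 'C(d - j, k)%:R * u ^+ k * (-1) ^+ (d - j - k) *
  (a (n + j)%N * b ^+ (d - j)).
have -> : (jensenK a d n \Po (b *: (u *: 'X - 1)))`_k = \sum_(0 <= j < d.+1) G j.
  rewrite /jensenK raddf_sum /= coef_sum big_mkord; apply: eq_bigr => j _.
  rewrite comp_polyZ comp_Xn_poly coefZ exprZn coefZ coef_exp_linear.
  by rewrite /G; ring.
have [dk|kd] := ltnP d k.
  rewrite bin_small // !mul0r big_mkord big1 // => j _.
  rewrite /G ['C(d - j, k)]bin_small ?mulr0 ?mul0r //.
  exact: leq_ltn_trans (leq_subr _ _) dk.
rewrite (@big_cat_nat _ _ _ (d - k).+1) //=; last by rewrite ltnS leq_subr.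
rewrite [X in _ + X]big_nat [X in _ + X]big1 ?addr0; last first.
  move=> j /andP[jk jd]; rewrite /G ['C(d - j, k)]bin_small ?mulr0 ?mul0r //.
  by lia.
rewrite big_mkord /altsum mulr_sumr; apply: eq_bigr => i _.
have ir : (i <= d - k)%N by rewrite -ltnS.
have id : (i <= d)%N by rewrite (leq_trans ir) ?leq_subr.
(* By symmetry of the binomials, this is [mul_bin_bin] with [d - k - i] in place of [i]. *)
have -> : G i = 'C(d, k)%:R * 'C(d - k, i)%:R * u ^+ k * (-1) ^+ (d - k - i) *
    (a (n + i)%N * b ^+ (d - i)).
  rewrite /G -!natrM [(d - i - k)%N]subnAC; congr (_%:R * _ * _ * _).
  rewrite -(bin_sub id) -(bin_sub ir) -mul_bin_bin; last by lia.
  by rewrite (_ : (k + (d - k - i) = d - i)%N) //; lia.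
have -> : (-1) ^+ (d - k - i) = (-1) ^+ (d - k) * (-1) ^+ i :> R.
  have -> : (-1) ^+ (d - k) = (-1) ^+ (d - k - i) * (-1) ^+ i :> R.
    by rewrite -exprD subnK.
  by rewrite -mulrA -expr2 sqrr_sign mulr1.
have -> : b ^+ d = b ^+ (d - i) * b ^+ i by rewrite -exprD subnK.
by field; rewrite expf_neq0.
Qed.

(** * Coefficients of the Hermite limit *)

Lemma coef_expR_poly_comp (R : realType) (kappa : R) r :
  (expR_poly R r.+1 \Po (kappa *: 'X^2))`_r =
  if odd r then 0 else kappa ^+ r./2 / (r./2)`!%:R.
Proof.
rewrite /expR_poly poly_def raddf_sum /= coef_sum.
have tE (l : 'I_r.+1) : ((l`!%:R)^-1 *: 'X^l \Po (kappa *: 'X^2))`_r =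
    if r == (2 * l)%N then kappa ^+ l / l`!%:R else 0.
  rewrite comp_polyZ comp_Xn_poly exprZn -exprM !coefZ coefXn.
  by case: eqP => _; rewrite ?mulr0 // mulr1 mulrC.
rewrite (eq_bigr _ (fun i _ => tE i)); case: ifP => [ro|re].
  by rewrite big1 // => l _; case: eqP => // rl; rewrite rl mul2n odd_double in ro.
have rE : r = (2 * r./2)%N by rewrite mul2n halfK re subn0.
have hr : (r./2 < r.+1)%N by lia.
rewrite (bigD1 (Ordinal hr)) //= -rE eqxx big1 ?addr0 // => l.
by rewrite -val_eqE /= => lr; case: eqP => // rl; lia.
Qed.

Lemma coef_hj_target (R : realType) (kappa : R) d k :
  kappa = 1 \/ kappa = -1 ->
  (hj_target kappa d)`_k =
  ('C(d, k)%:R * ((d - k)`!%:R * (expR_poly R (d - k).+1 \Po (kappa *: 'X^2))`_(d - k)))%:C%C.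
Proof.
move=> kappaP.
pose c s := kappa ^+ s * d`!%:R / (s`!%:R * (d - 2 * s)`!%:R).
have comp_hermite (z : R[i]) : hermite R[i] d \Po (z *: 'X) =
    \sum_(s < d./2.+1) (((-1) ^+ s * d`!%:R / (s`!%:R * (d - 2 * s)`!%:R)) *
       (2 * z) ^+ (d - 2 * s)) *: 'X^(d - 2 * s).
  rewrite /hermite raddf_sum /=; apply: eq_bigr => s _.
  by rewrite comp_polyZ rmorphXn /= comp_polyZ comp_polyX scalerA exprZn scalerA.
have -> : hj_target kappa d = \sum_(s < d./2.+1) (c s)%:C%C *: 'X^(d - 2 * s).
  have cC s : (c s)%:C%C = (kappa%:C%C) ^+ s * d`!%:R / (s`!%:R * (d - 2 * s)`!%:R).
    by rewrite /c !rmorphM fmorphV rmorphM !rmorph_nat rmorphXn.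
  rewrite /hj_target !comp_hermite; case: kappaP => kE; rewrite kE.
    rewrite (_ : (1 == -1 :> R) = false); last by apply/negbTE; rewrite -subr_eq0; lra.
    rewrite scaler_sumr; apply: eq_bigr => s _; rewrite scalerA cC kE; congr (_ *: _).
    have i0 : 'i%C != 0 :> R[i] by rewrite neq0Ci.
    have -> : 2 * ('i%C / 2) = 'i%C :> R[i] by field.
    have sd : (2 * s <= d)%N by move: (ltn_ord s); lia.
    (* Dividing by this power leaves a sign that cancels the [(-1) ^+ s] of the Hermite polynomial,
       in accordance with [kappa ^+ s = 1]. *)
    have -> : 'i%C ^+ d = 'i%C ^+ (d - 2 * s) * (-1) ^+ s :> R[i].
      by rewrite -sqr_i -exprM -exprD subnK.
    rewrite rmorph1 expr1n; field.
    by rewrite !pnatr_eq0 -!lt0n !fact_gt0 signr_eq0 expf_neq0.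
  rewrite eqxx; apply: eq_bigr => s _; congr (_ *: _).
  by rewrite cC kE mulfV ?pnatr_eq0 // expr1n mulr1 rmorphN1.
rewrite coef_sum.
have tE (s : 'I_d./2.+1) : ((c s)%:C%C *: 'X^(d - 2 * s))`_k =
    (if k == (d - 2 * s)%N then c s else 0)%:C%C.
  by rewrite coefZ coefXn; case: eqP => _; rewrite ?mulr1 ?mulr0 ?rmorph0.
rewrite (eq_bigr _ (fun i _ => tE i)) -raddf_sum /=; congr (_%:C%C).
have [dk|kd] := ltnP d k.
  rewrite bin_small // mul0r big1 // => s _; case: eqP => // ks; lia.
rewrite coef_expR_poly_comp; case: ifP => [ro|re].
  rewrite !mulr0 big1 // => s _; case: eqP => // ks.
  have := ltn_ord s; rewrite ltnS => sd.
  have : (d - k = 2 * s)%N by lia.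
  by move=> e; rewrite e mul2n odd_double in ro.
have rE : (d - k = 2 * (d - k)./2)%N by rewrite mul2n halfK re subn0.
have hr : ((d - k)./2 < d./2.+1)%N by rewrite ltnS half_leq ?leq_subr.
rewrite (bigD1 (Ordinal hr)) //= -rE subKn // eqxx big1 ?addr0; last first.
  move=> s; rewrite -val_eqE /= => ls; case: eqP => // ks.
  by have := ltn_ord s; lia.
rewrite /c -rE subKn // -(bin_fact kd) !natrM; field.
by rewrite !pnatr_eq0 -!lt0n !fact_gt0.
Qed.

(** * Application to the log-polynomial expansion *)

Unset Implicit Arguments.

Theorem theorem2p1 (R : realType) (a : nat -> R) (m : nat)
    (A : nat -> R) (kappa : R) (delta : nat -> R)
    (Astar deltastar : nat -> R) :
  log_polynomial a m A kappa delta ->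
  (forall n, 0 < deltastar n) ->
  (fun n => (Astar n - A n) / delta n) @ \oo --> 0 ->
  (fun n => deltastar n / delta n) @ \oo --> (1 : R) ->
  forall d : nat, (1 <= d <= m.+1)%N ->
    hermite_jensen a d Astar kappa deltastar.
Proof.
move=> [m2 kappaP a_gt0 [delta_gt0 delta0] [g [Elog gk]]] ds_gt0 AsA dsd d
  /andP[d1 dm].
have dN0 n : delta n != 0 by rewrite gt_eqF.
have dsN0 n : deltastar n != 0 by rewrite gt_eqF.
have aN0 n : a n != 0 by rewrite gt_eqF.
have bN0 n : expR (Astar n) != 0 by rewrite gt_eqF ?expR_gt0.
pose E n j := ln (a (n + j)%N / a n) - Astar n * j%:R.
(* Coefficients of the expansion in the variable [delta n * j]: each one is divided by
   [delta n ^+ k], and the linear one absorbs the change from [A] to [Astar]. *)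
pose c n k := match k with
  | 0 => 0 | 1 => (A n - Astar n) / delta n | 2 => kappa
  | _ => g k n / delta n ^+ k end.
pose Q n := \poly_(k < m.+1) c n k.
pose L : {poly R} := kappa *: 'X^2.
have expE n j : expR (E n j) = a (n + j)%N / expR (Astar n) ^+ j / a n.
  by rewrite expRB lnK ?posrE ?divr_gt0 // expRM_natr mulrAC.
have QE n x : (Q n).[delta n * x] = (A n - Astar n) * x +
    kappa * delta n ^+ 2 * x ^+ 2 + \sum_(3 <= k < m.+1) g k n * x ^+ k.
  rewrite (horner_scaled _ _ (size_poly _ _)).
  transitivity (\sum_(0 <= q < m.+1) c n q * delta n ^+ q * x ^+ q).
    by rewrite big_mkord; apply: eq_bigr => q _; rewrite coef_poly ltn_ord.
  rewrite big_ltn // big_ltn 1?ltnW // big_ltn //= !mul0r add0r addrA.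
  congr (_ + _ + _); first by rewrite !expr1 divfK.
  apply: eq_big_nat => -[|[|[|q]]] // _ /=.
  by rewrite divfK ?expf_neq0.
have Q0 n : (Q n)`_0 = 0 by rewrite coef_poly.
have EQ j : (j <= m.+1)%N ->
    (fun n => (E n j - (Q n).[delta n * j%:R]) / delta n ^+ m.+1) @ \oo --> 0.
  (* The expansion is assumed only for [j >= 1]; at [j = 0] both terms vanish, by [ln 1 = 0] and the
     zero constant term. *)
  case: j => [|j] jm.
    under eq_fun => n.
      rewrite /E addn0 divff // ln1 !mulr0 subr0 horner_coef0 Q0 subr0 mul0r.
      over.
    exact: cvg_cst.
  apply: cvg_trans (Elog j.+1 jm); apply/near_eq_cvg/nearW => n.
  by rewrite QE /E; congr (_ / _); ring.
have QL : coef_cvg Q L.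
  move=> k; rewrite coefZ coefXn.
  under eq_fun do rewrite coef_poly.
  case: ltnP => [km|mk]; last first.
    by rewrite gtn_eqF ?mulr0; [exact: cvg_cst | exact: leq_ltn_trans m2 mk].
  case: k km => [|[|[|k]]] km; rewrite /= ?mulr0 ?mulr1; try exact: cvg_cst.
    have -> : (fun n => (A n - Astar n) / delta n) =
        (fun n => - ((Astar n - A n) / delta n)).
      by apply/funext => n; rewrite -mulNr opprB.
    by rewrite -oppr0; exact: cvgN.
  exact: gk.
(* The base [k] stays free: J uses base [k] and K uses base 0. The samples involved stop at [k + r],
   within the range of the expansion. *)
have diff_cvg k r : (k + r <= m.+1)%N ->
    (fun n => altsum (fun i => a (n + (k + i))%N / expR (Astar n) ^+ (k + i)) r
       / a n / deltastar n ^+ r)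
    @ \oo --> r`!%:R * (expR_poly R r.+1 \Po L)`_r.
  move=> krm.
  (* The sign may be inserted because the coefficient is 0 for odd [r]; the power of [1^-1] is the
     limit contributed by [deltastar n / delta n]. *)
  have limE : r`!%:R * (expR_poly R r.+1 \Po L)`_r =
      (-1) ^+ r * r`!%:R * (expR_poly R r.+1 \Po L)`_r * 1^-1 ^+ r.
    rewrite invr1 expr1n mulr1 coef_expR_poly_comp -signr_odd.
    by case: odd; rewrite ?mulr0 // mul1r.
  rewrite limE.
  have -> : (fun n =>
      altsum (fun i => a (n + (k + i))%N / expR (Astar n) ^+ (k + i)) r
        / a n / deltastar n ^+ r) =
      (fun n => altsum (fun i => expR (E n (k + i)%N)) r / delta n ^+ r *
        (deltastar n / delta n)^-1 ^+ r).
    apply/funext => n; rewrite invf_div expr_div_n.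
    have -> : altsum (fun i => expR (E n (k + i)%N)) r =
        altsum (fun i => a (n + (k + i))%N / expR (Astar n) ^+ (k + i)) r / a n.
      rewrite /altsum mulr_suml; apply: eq_bigr => i _.
      by rewrite expE !mulrA.
    by field; rewrite aN0 !expf_neq0.
  apply: cvgM; last first.
        apply: (@cvg_pow_seq _ (fun n => (deltastar n / delta n)^-1)).
    by apply: cvgV => //; exact: oner_neq0.
  apply: (@cvg_altsum_expR _ _ delta_gt0 delta0 _ Q _ m.+1) => //.
  - by move=> n; exact: size_poly.
  - by rewrite (leq_trans (size_scale_leq _ _)) ?size_polyXn.
  - by rewrite coefZ coefXn mulr0.
  - move=> j jkr; apply: (cvg_div_delta_le delta_gt0 delta0 (s := m.+1)).
      exact: leq_trans (leq_addl k r) krm.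
    by apply: EQ; exact: leq_trans jkr krm.
have poly_cvgP (P : nat -> {poly R}) :
    (forall k, (fun n => (P n)`_k) @ \oo -->
      'C(d, k)%:R * ((d - k)`!%:R * (expR_poly R (d - k).+1 \Po L)`_(d - k))) ->
    poly_cvg P (hj_target kappa d).
  (* The limit coefficients are real, so the imaginary parts are constantly 0. *)
  by move=> PL k; rewrite coef_hj_target //; split => //=; exact: cvg_cst.
split=> //; apply: poly_cvgP => k.
- have -> : (fun n => ((deltastar n ^- d / a n) *:
        (jensenJ a d n \Po (deltastar n *: 'X - 1) * ((expR (Astar n))^-1)%:P))`_k) =
      (fun n => 'C(d, k)%:R *
        (altsum (fun i => a (n + (k + i))%N / expR (Astar n) ^+ (k + i)) (d - k)
          / a n / deltastar n ^+ (d - k))).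
    apply/funext => n; rewrite coefZ coef_jensenJ_comp.
    (* For [k > d] the truncated subtraction [d - k] is meaningless, but ['C(d, k)] is 0. *)
    have [dk|kd] := ltnP d k; first by rewrite bin_small // !mul0r mulr0.
    have -> : deltastar n ^+ d = deltastar n ^+ (d - k) * deltastar n ^+ k.
      by rewrite -exprD subnK.
    by field; rewrite aN0 !expf_neq0.
  have [dk|kd] := ltnP d k.
    by rewrite bin_small // mul0r; under eq_fun do rewrite mul0r; exact: cvg_cst.
  by apply: cvgM; [exact: cvg_cst | apply: diff_cvg; rewrite subnKC].
- have -> : (fun n => (((expR (Astar n) * deltastar n) ^- d / a n) *:
        (jensenK a d n \Po expR (Astar n) *: (deltastar n *: 'X - 1)))`_k) =
      (fun n => 'C(d, k)%:R * ((-1) ^+ (d - k) *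
        (altsum (fun i => a (n + (0 + i))%N / expR (Astar n) ^+ (0 + i)) (d - k)
          / a n / deltastar n ^+ (d - k)))).
    apply/funext => n; rewrite coefZ coef_jensenK_comp //.
    have [dk|kd] := ltnP d k; first by rewrite bin_small // !mul0r mulr0.
    have -> : (expR (Astar n) * deltastar n) ^+ d =
        expR (Astar n) ^+ d * (deltastar n ^+ (d - k) * deltastar n ^+ k).
      by rewrite exprMn -exprD subnK.
    rewrite /altsum; under [in RHS]eq_bigr do rewrite add0n.
    by field; rewrite aN0 !expf_neq0.
  (* The extra sign of the K coefficients is harmless for the same parity reason. *)
  have -> : (d - k)`!%:R * (expR_poly R (d - k).+1 \Po L)`_(d - k) =
      (-1) ^+ (d - k) * ((d - k)`!%:R * (expR_poly R (d - k).+1 \Po L)`_(d - k)).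
    rewrite coef_expR_poly_comp -signr_odd.
    by case: odd; rewrite ?mulr0 // mul1r.
  apply: cvgM; first exact: cvg_cst.
  apply: cvgM; first exact: cvg_cst.
  by apply: diff_cvg; rewrite add0n (leq_trans (leq_subr _ _)).
Qed.
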